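(* Let $X$ be a set of variables with $|X|>1$ and let $*$ be an associative product on $K[X]^+$. Then the following are equivalent: (i) $*$ is $\mathrm{id}$-matching with $\cdot$; (ii) $*$ is $(12)$-matching with $\cdot$; (iii) $*$ is interchangeable with $\cdot$; (iv) $*$ is totally compatible with $\cdot$; (v) $*$ is determined by some $\varphi\in\Gamma(K[X]^+)$, i.e. $a*b=\varphi(a\cdot b)$ for all $a,b\in K[X]^+$.
   Context: All algebras and vector spaces are over a field $K$ and all products are binary and bilinear. $K[X]$ is the polynomial algebra over $K$ in the (possibly infinitely many) variables $X$ with its usual product $\cdot$, and $K[X]^+$ (the free non-unital commutative associative algebra over $X$) is its ideal of polynomials with zero constant term. For an associative algebra $(A,\cdot)$ and an associative product $*$ on $A$: - $*$ is $\mathrm{id}$-matching with $\cdot$ if $(a*b)\cdot c=a*(b\cdot c)$ and $(a\cdot b)*c=a\cdot(b*c)$ for all $a,b,c\in A$; - $*$ is $(12)$-matching with $\cdot$ if $(a*b)\cdot c=a\cdot(b*c)$ and $(a\cdot b)*c=a*(b\cdot c)$ for all $a,b,c\in A$; - $*$ is interchangeable with $\cdot$ if $(a*b)\cdot c=(a\cdot b)*c$ and $a*(b\cdot c)=a\cdot(b*c)$ for all $a,b,c\in A$; - $*$ is totally compatible with $\cdot$ if $(a*b)\cdot c=(a\cdot b)*c=a*(b\cdot c)=a\cdot(b*c)$ for all $a,b,c\in A$. The centroid $\Gamma(A)$ is the space of linear maps $\varphi:A\to A$ with $x\cdot\varphi(y)=\varphi(x\cdot y)=\varphi(x)\cdot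 y$ for all $x,y\in A$. *)

(* Defs.v *)
From HB Require Import structures.
From mathcomp Require Import all_boot all_order all_algebra.
From mathcomp Require Import finmap monalg.

Set Implicit Arguments.
Unset Strict Implicit.
Unset Printing Implicit Defensive.

Import GRing.Theory.
Local Open Scope ring_scope.

Section Products.
Variables (K : fieldType) (A : lmodType K).
Implicit Types (dot star : A -> A -> A).

Definition id_matching dot star : Prop :=
  forall a b c : A,
    dot (star a b) c = star a (dot b c) /\ star (dot a b) c = dot a (star b c).

Definition matching12 dot star : Prop :=
  forall a b c : A,
    dot (star a b) c = dot a (star b c) /\ star (dot a b) c = star a (dot b c).

Definition interchangeable dot star : Prop :=
  forall a b c : A,
    dot (star a b) c = star (dot a b) c /\ star a (dot b c) = dot a (star b c).

Definition totally_compatible dot star : Prop :=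
  forall a b c : A,
    [/\ dot (star a b) c = star (dot a b) c,
        star (dot a b) c = star a (dot b c)
      & star a (dot b c) = dot a (star b c)].

Definition bilinear_product star : Prop := bilinear_for *:%R *:%R star.

Definition in_centroid dot (phi : {linear A -> A}) : Prop :=
  forall x y : A,
    dot x (phi y) = phi (dot x y) /\ phi (dot x y) = dot (phi x) y.

End Products.

(* The commutative monomials over X are the finitely supported functions
   X -> nat, so their monoid algebra is K[X] for an arbitrary, possibly
   infinite, X. *)
Notation polyX K X := {malg K[{cmonom X}]}.

Section PositivePolynomials.
Variables (K : fieldType) (X : choiceType).

(* The coefficient at the monomial 1 is the constant term. *)
Definition zero_const : {pred polyX K X} :=
  fun p => p@_(mone : {cmonom X}) == 0.

Lemma zero_const_submod : submod_closed zero_const.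
Proof.
split=> [|c p q]; rewrite !unfold_in ?mcoeff0 //.
by move=> /eqP p0 /eqP q0; rewrite mcoeffD mcoeffZ p0 q0 mulr0 addr0.
Qed.

HB.instance Definition _ :=
  GRing.isSubmodClosed.Build K (polyX K X) zero_const zero_const_submod.

Record polyXplus := PolyXplus {
  polyXplus_val :> polyX K X;
  polyXplus_const : polyXplus_val \in zero_const
}.

HB.instance Definition _ := [isSub for polyXplus_val].
HB.instance Definition _ := [Choice of polyXplus by <:].
HB.instance Definition _ := [SubChoice_isSubLmodule of polyXplus by <:].

Lemma zero_constM (p q : polyXplus) :
  polyXplus_val p * polyXplus_val q \in zero_const.
Proof.
have /eqP p0 : (polyXplus_val p)@_(mone : {cmonom X}) == 0.
  exact: polyXplus_const.
by rewrite unfold_in (rmorphM (mcoeff (mone : {cmonom X}))) /= p0 mul0r.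
Qed.

Definition mulplus (p q : polyXplus) : polyXplus := PolyXplus (zero_constM p q).

End PositivePolynomials.

Arguments mulplus {K X} p q.

(* Main.v *)
Require Import Defs.
From HB Require Import structures.
From mathcomp Require Import all_boot all_order all_algebra.
From mathcomp Require Import finmap monalg.

Set Implicit Arguments.
Unset Strict Implicit.
Unset Printing Implicit Defensive.

Import GRing.Theory.
Local Open Scope ring_scope.

(** In a commutative associative algebra each of the identities forces
    [(a * b) . t . t = a . b . (t * t)]: the star can be moved from the pair
    [(a, b)] to the pair [(t, t)].  In the field of fractions this says that
    [(a * b) / (a . b)] is a constant [f], namely [(t * t) / t^2] for every
    [t].

    The constant is a polynomial because there are two variables [x] and [y].
    Taking [t = x] and [t = y] gives [(x * x) . y^2 = (y * y) . x^2], and since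
    [x^2] and [y^2] are coprime, [x^2] divides [x * x]
    ([coprime_square_fraction]).  Fractions are avoided by the linear operator
    [quo_var x], which divides by [x] the monomials containing [x] and kills
    the others: it is a left inverse of multiplication by [x], and commutes with
    multiplication by [y].

    Hence [a * b = f . (a . b)], and multiplication by [f] is an element of the
    centroid.  Conversely, a centroid element can be moved freely across
    products, so a star of this form is totally compatible, which implies the
    other three identities. *)

(** * Compatible products in a commutative associative algebra *)

Section CommutativeAlgebra.
Variables (K : fieldType) (A : lmodType K) (dot star : A -> A -> A).
Hypotheses (dotA : associative dot) (dotC : commutative dot).

(** Division-free form of the statement that the ratio of [star a b] to
    [dot a b] does not depend on [a] and [b]. *)
Definition constant_ratio : Prop :=
  forall a b t : A,
    dot (dot (star a b) t) t = dot (dot a b) (star t t).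

Let dotAC : right_commutative dot.
Proof. by move=> a b c; rewrite -!dotA (dotC b). Qed.

Lemma id_matching_constant_ratio : id_matching dot star -> constant_ratio.
Proof.
move=> H a b t.
have outr u v w : dot (star u v) w = star u (dot v w) by case: (H u v w).
have outl u v w : star (dot u v) w = dot u (star v w) by case: (H u v w).
(* By commutativity of dot, b leaves the star in exchange for one t, and then
   a leaves it in exchange for the other t. *)
rewrite outr (dotC b) -outr dotAC (dotC _ t) -outl (dotC t) outl.
by rewrite dotAC.
Qed.

Lemma matching12_constant_ratio : matching12 dot star -> constant_ratio.
Proof.
move=> H a b t.
have slide u v w : dot (star u v) w = dot u (star v w) by case: (H u v w).
by rewrite slide -dotA slide dotA.
Qed.

Lemma interchangeable_constant_ratio :
  interchangeable dot star -> constant_ratio.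
Proof.
move=> H a b t.
have outl u v w : dot (star u v) w = star (dot u v) w by case: (H u v w).
have outr u v w : star u (dot v w) = dot u (star v w) by case: (H u v w).
(* Both sides are star (dot a b) (dot t t). *)
by rewrite -dotA outl outr.
Qed.

Lemma totally_compatible_id_matching :
  totally_compatible dot star -> id_matching dot star.
Proof. by move=> H a b c; have [-> -> ->] := H a b c. Qed.

Lemma totally_compatible_matching12 :
  totally_compatible dot star -> matching12 dot star.
Proof. by move=> H a b c; have [-> -> ->] := H a b c. Qed.

Lemma totally_compatible_interchangeable :
  totally_compatible dot star -> interchangeable dot star.
Proof. by move=> H a b c; have [-> -> ->] := H a b c. Qed.

(** All four products equal [phi (a . b . c)]. *)
Lemma centroid_totally_compatible (phi : {linear A -> A}) :
    in_centroid dot phi -> (forall a b, star a b = phi (dot a b)) ->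
  totally_compatible dot star.
Proof.
move=> phiP starE a b c; rewrite !starE; split.
- by have [_ ->] := phiP (dot a b) c.
- by rewrite dotA.
- by have [-> _] := phiP a (dot b c).
Qed.

End CommutativeAlgebra.

(** * Fractions with coprime square denominators *)

(** A common value of [p / u^2] and [q / v^2] has no denominator when [u] and
    [v] are coprime.  Coprimality is expressed by a division [quo] by [u]
    through which multiplication by [v] passes: dividing the equation
    [v^2 * p = u^2 * q] twice by [u] gives [v^2 * f = q], and then
    [p = u^2 * f], with [f] the result of dividing [p] twice. *)
Lemma coprime_square_fraction (S : comNzRingType) (quo : S -> S) (u v p q : S) :
    cancel ( *%R u) quo -> (forall r, quo (v * r) = v * quo r) ->
    injective ( *%R v) ->
    v * (v * p) = u * (u * q) ->
  exists f, forall s d, u * (u * s) = d * p -> s = f * d.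
Proof.
move=> quoK quoM vI E; exists (quo (quo p)) => s d sE.
have qE : q = v * (v * quo (quo p)) by rewrite -!quoM E !quoK.
have pE : p = u * (u * quo (quo p)).
  by do 2!apply: (vI); rewrite E qE !(mulrCA u).
by do 2!apply: (can_inj quoK); rewrite sE {1}pE mulrC -!mulrA.
Qed.

(** * Division by a variable *)

Section QuotientByVariable.
Variables (K : fieldType) (X : choiceType).
Implicit Types (x y : X) (m : {cmonom X}) (p q : {malg K[{cmonom X}]}).

Definition var x : {malg K[{cmonom X}]} := << ucm x >>.

Definition quo_monom x m : {malg K[{cmonom X}]} :=
  if m x == 0%N then 0 else << divcm m (ucm x) >>.

(** Linear extension of [quo_monom x]; the coefficients are embedded as
    constants, and monomials without [x] go to zero so that the operator is
    linear over the polynomials in the other variables. *)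
Definition quo_var x p : {malg K[{cmonom X}]} :=
  mmap (@mkmalgU {cmonom X} K mone) (quo_monom x) p.

Lemma monalg_ind (P : {malg K[{cmonom X}]} -> Prop) :
    P 0 -> (forall p q, P p -> P q -> P (p + q)) ->
    (forall c m, P << c *g m >>) ->
  forall p, P p.
Proof. by move=> P0 PD PU p; rewrite [p]monalgE; apply: big_ind. Qed.

Lemma quo_var0 x : quo_var x 0 = 0.
Proof. exact: raddf0. Qed.

Lemma quo_varD x : {morph quo_var x : p q / p + q}.
Proof. exact: raddfD. Qed.

Lemma quo_varU x c m : quo_var x << c *g m >> = c *: quo_monom x m.
Proof. by rewrite /quo_var mmapU mul_malgC. Qed.

Lemma varMU x c m : var x * << c *g m >> = << c *g mmul (ucm x) m >>.
Proof. by rewrite malgM_def fgmulUU mul1r. Qed.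

Lemma varMU1 x m : var x * << m >> = << mmul (ucm x) m >>.
Proof. exact: varMU. Qed.

Lemma scaleU1 c m : c *: (<< m >> : {malg K[{cmonom X}]}) = << c *g m >>.
Proof.
by rewrite -(mul_malgC c << m >>) malgM_def fgmulUU mulr1 mul1m.
Qed.

Lemma quo_monom_mul x m : quo_monom x (mmul (ucm x) m) = << m >>.
Proof.
rewrite /quo_monom cmM cmUU /=; congr << _ >>.
by apply/eqP/cmP => i; rewrite divcmE cmM addKn.
Qed.

Lemma quo_monom_mul_neq x y m : x != y ->
  quo_monom x (mmul (ucm y) m) = var y * quo_monom x m.
Proof.
rewrite eq_sym => /negPf yx; rewrite /quo_monom cmM cmU yx add0n.
case: eqP => [_|/eqP mx]; first by rewrite mulr0.
rewrite varMU1; congr << _ >>; apply/eqP/cmP => i.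
rewrite divcmE !cmM divcmE !cmU.
have [<-|_] := eqVneq x i; last by rewrite !subn0.
by rewrite yx.
Qed.

Lemma quo_varK x : cancel ( *%R (var x)) (quo_var x).
Proof.
elim/monalg_ind => [|p q IHp IHq|c m]; first by rewrite mulr0 quo_var0.
  by rewrite mulrDr quo_varD; congr (_ + _).
by rewrite varMU quo_varU quo_monom_mul scaleU1.
Qed.

Lemma quo_var_mul_neq x y p : x != y ->
  quo_var x (var y * p) = var y * quo_var x p.
Proof.
move=> xy; elim/monalg_ind: p => [|p q IHp IHq|c m].
- by rewrite mulr0 quo_var0 mulr0.
- rewrite mulrDr [LHS]quo_varD [X in _ = _ * X]quo_varD [RHS]mulrDr.
  by rewrite [X in X + _ = _]IHp [X in _ + X = _]IHq.
- by rewrite varMU [LHS]quo_varU quo_varU quo_monom_mul_neq // [LHS]scalerAr.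
Qed.

Lemma varI x : injective ( *%R (var x)).
Proof. exact: can_inj (quo_varK x). Qed.

Lemma zero_const_mull f p : p \in @zero_const K X -> f * p \in @zero_const K X.
Proof.
rewrite !unfold_in => /eqP p0.
by rewrite (rmorphM (mcoeff (mone : {cmonom X}))) /= p0 mulr0.
Qed.

Lemma var_zero_const x : var x \in @zero_const K X.
Proof. by rewrite unfold_in mcoeffU1 cm1_eq1. Qed.

End QuotientByVariable.

(** * Products on polynomials without constant term *)

Section PositivePolynomials.
Variables (K : fieldType) (X : choiceType).
Implicit Types a b c : polyXplus K X.

Lemma mulplusA : associative (@mulplus K X).
Proof. by move=> a b c; apply: val_inj; rewrite /= mulrA. Qed.

Lemma mulplusC : commutative (@mulplus K X).
Proof. by move=> a b; apply: val_inj; rewrite /= mulrC. Qed.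

Section CentroidMul.
Variable f : {malg K[{cmonom X}]}.

(** The factor [f] ranges over the unital algebra: the centroid contains the
    identity and the other scalars, for which [f] is a constant polynomial. *)
Definition centroid_mul a : polyXplus K X :=
  PolyXplus (zero_const_mull f (polyXplus_const a)).

Lemma centroid_mul_is_linear : linear centroid_mul.
Proof.
move=> k a b; apply: val_inj.
by rewrite linearP /= mulrDr [in RHS]scalerAr.
Qed.

HB.instance Definition _ :=
  GRing.isLinear.Build K (polyXplus K X) (polyXplus K X) _ centroid_mul
    centroid_mul_is_linear.

Lemma centroid_mulP : in_centroid mulplus centroid_mul.
Proof.
move=> a b; split; apply: val_inj; first exact: (mulrCA (val a)).
exact: (mulrA f).
Qed.

End CentroidMul.

(** Comparing the ratio at two distinct variables shows that it is a polynomial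
    [f]; multiplication by [f] is then the required centroid element. *)
Lemma constant_ratio_centroid (star : polyXplus K X -> polyXplus K X ->
    polyXplus K X) :
    (exists x y : X, x != y) -> constant_ratio mulplus star ->
  exists phi : {linear polyXplus K X -> polyXplus K X},
    in_centroid mulplus phi /\ forall a b, star a b = phi (mulplus a b).
Proof.
move=> [x [y xy]] ratio.
pose V (z : X) := PolyXplus (var_zero_const K z).
have ratio_var a b z : var K z * (var K z * val (star a b))
    = val a * val b * val (star (V z) (V z)).
  have /(congr1 val) /= <- := ratio a b (V z).
  by rewrite [LHS]mulrC (mulrC (var K z)).
have cross : var K y * (var K y * val (star (V x) (V x)))
    = var K x * (var K x * val (star (V y) (V y))).
  exact: etrans (ratio_var _ _ y) (esym (mulrA _ _ _)).
have [f fP] := coprime_square_fraction (quo_varK x)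
  (fun r => quo_var_mul_neq r xy) (@varI _ _ y) cross.
exists (centroid_mul f); split; first exact: centroid_mulP.
by move=> a b; apply: val_inj; exact: (fP _ _ (ratio_var a b x)).
Qed.

End PositivePolynomials.

Theorem proposition4p12 (K : fieldType) (X : choiceType)
    (hX : exists x y : X, x != y)
    (star : polyXplus K X -> polyXplus K X -> polyXplus K X)
    (star_bilinear : bilinear_product star)
    (star_assoc : associative star) :
  [<-> id_matching mulplus star;
       matching12 mulplus star;
       interchangeable mulplus star;
       totally_compatible mulplus star;
       exists phi : {linear polyXplus K X -> polyXplus K X},
         in_centroid mulplus phi /\
         forall a b : polyXplus K X, star a b = phi (mulplus a b)].
Proof.
have dotA := @mulplusA K X.
have dotC := @mulplusC K X.
have ratio_total :
    constant_ratio mulplus star -> totally_compatible mulplus star.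
  move=> /(constant_ratio_centroid hX) [phi [phiP starE]].
  exact: centroid_totally_compatible phiP starE.
tfae.
- move=> /(id_matching_constant_ratio dotA dotC) /ratio_total.
  exact: totally_compatible_matching12.
- move=> /(matching12_constant_ratio dotA) /ratio_total.
  exact: totally_compatible_interchangeable.
- by move=> /(interchangeable_constant_ratio dotA) /ratio_total.
- move=> /totally_compatible_matching12 /(matching12_constant_ratio dotA).
  exact: constant_ratio_centroid.
- move=> [phi [phiP starE]]; apply: totally_compatible_id_matching.
  exact: centroid_totally_compatible phiP starE.
Qed.
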